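(* Let $E,Q\in M_n(\mathbb C)$ be such that $E^*Q$ is Hermitian and at least one of $E$ and $Q$ is nonsingular. Then there exist $U,V\in GL_n(\mathbb C)$ such that $$(UEV,U^{-*}QV)=\bigoplus_{i=1}^{n}(A_i,B_i),$$ where each $(A_i,B_i)$ is a pair of $1\times 1$ matrices with $(A_i,B_i)\in\{(1,1),(1,-1),(1,0)\}$ if $E$ is nonsingular, and $(A_i,B_i)\in\{(1,1),(1,-1),(0,1)\}$ if $Q$ is nonsingular. If in addition $E^*Q$ is positive semidefinite, then no summand $(1,-1)$ occurs. The canonical form is uniquely determined by $(E,Q)$ up to permutation of summands.
   Context: $M_n(\mathbb C)$ is the set of $n\times n$ complex matrices, $GL_n(\mathbb C)$ the nonsingular ones, $A^*$ is the conjugate transpose, $A^{-*}=(A^{-1})^*$. The direct sum of pairs is $(A,B)\oplus(C,D):=(A\oplus C,B\oplus D)$, where $\oplus$ on matrices is the block-diagonal direct sum. *)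

(* Defs.v *)
From mathcomp Require Import all_boot all_order perm all_algebra.
From mathcomp Require Import sesquilinear spectral.
From mathcomp Require Import complex reals.

Set Implicit Arguments.
Unset Strict Implicit.
Unset Printing Implicit Defensive.

Import Order.TTheory GRing.Theory Num.Theory.

Local Open Scope ring_scope.
Local Open Scope sesquilinear_scope.

(* In the order of [R[i]], [0 <= z] also says that [z] is real. *)
Definition psdmx (R : realType) n (M : 'M[R[i]]_n) : Prop :=
  M \is hermsymmx /\ forall x : 'cV[R[i]]_n, 0 <= (x ^t* *m M *m x) 0 0.

Lemma sum_ones n : (\sum_(i < n) 1)%N = n.
Proof. by rewrite sum1_card card_ord. Qed.

(* The cast identifies the dimension [\sum_(i < n) 1] of [\mxdiag] with [n]. *)
Definition dsum11 (R : realType) n (A : 'I_n -> 'M[R[i]]_1) : 'M[R[i]]_n :=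
  castmx (sum_ones n, sum_ones n) (\mxdiag_(i < n) A i).

Definition pair_dsum11 (R : realType) n (d : 'I_n -> 'M[R[i]]_1 * 'M[R[i]]_1) :
    'M[R[i]]_n * 'M[R[i]]_n :=
  (dsum11 (fun i => (d i).1), dsum11 (fun i => (d i).2)).

Definition pair_canonical_form (R : realType) n (E Q : 'M[R[i]]_n)
    (d : 'I_n -> 'M[R[i]]_1 * 'M[R[i]]_1) : Prop :=
  [/\ exists U V : 'M[R[i]]_n, [/\ U \in unitmx, V \in unitmx &
        (U *m E *m V, (invmx U) ^t* *m Q *m V) = pair_dsum11 d],
      E \in unitmx -> forall i, d i \in [:: (1, 1); (1, -1); (1, 0)]
    & Q \in unitmx -> forall i, d i \in [:: (1, 1); (1, -1); (0, 1)]].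

Lemma sig1_ones n (i : 'I_(\sum_(i < n) 1)) :
  tagnat.sig1 (p_ := fun=> 1%N) i = i :> nat.
Proof.
rewrite [RHS](tagnat.rect i) ord1 addn0.
by rewrite (big_ord_narrow (ltnW (ltn_ord _))) sum_ones.
Qed.

Lemma dsum11E (R : realType) n (A : 'I_n -> 'M[R[i]]_1) :
  dsum11 A = diag_mx (\row_i A i 0 0).
Proof.
have -> : dsum11 A =
    castmx (sum_ones n, sum_ones n) (\mxdiag_(i < n) diag_mx (A i)).
  congr castmx; apply: eq_mxdiag => i; apply/matrixP=> j k.
  by rewrite !ord1 mxE eqxx.
rewrite -diag_mxrow; apply/matrixP=> i j; rewrite castmxE !mxE.
rewrite -(inj_eq val_inj) /= !ord1; congr (A _ _ _ *+ _).
by apply: val_inj; rewrite /= sig1_ones.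
Qed.

(* Main.v *)
(* The pair transformation turns E^*Q into V^*(E^*Q)V, so everything reduces to
   Hermitian congruence of M = E^*Q. The spectral theorem and a rescaling give
   V^*MV = diag(s) with s_i in {1, -1, 0}. If E is nonsingular take
   U = (EV)^-1; if Q is nonsingular let b_i = s_i (or 1 when s_i = 0) and choose
   U so that U^-* Q V = diag(b), which forces UEV = diag(b_i s_i). Conversely
   each summand (a, b) is determined by its sign conj(a) b, and the signs are
   unique up to order by Sylvester's law of inertia. *)

Require Import Defs.
From mathcomp Require Import all_boot all_order perm all_algebra.
From mathcomp Require Import sesquilinear spectral.
From mathcomp Require Import complex reals.

Set Implicit Arguments.
Unset Strict Implicit.
Unset Printing Implicit Defensive.

Import Order.TTheory GRing.Theory Num.Theory.

Local Open Scope ring_scope.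
Local Open Scope sesquilinear_scope.

(** * Hermitian congruence to a sign matrix and the law of inertia *)

Section Inertia.
Variable C : numClosedFieldType.

Lemma trmxC_mul m n p (A : 'M[C]_(m, n)) (B : 'M[C]_(n, p)) :
  (A *m B) ^t* = B ^t* *m A ^t*.
Proof. by rewrite trmx_mul map_mxM. Qed.

Lemma trmxC_unit n (A : 'M[C]_n) : (A ^t* \in unitmx) = (A \in unitmx).
Proof. by rewrite map_unitmx unitmx_tr. Qed.

Lemma trmxC_inv n (A : 'M[C]_n) : (invmx A) ^t* = invmx (A ^t*).
Proof. by rewrite trmx_inv map_invmx. Qed.

Lemma trmxC_diag n (x : 'rV[C]_n) : (diag_mx x) ^t* = diag_mx (map_mx Num.conj x).
Proof. by rewrite tr_diag_mx map_diag_mx. Qed.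

Lemma diag_mx_unit n (x : 'rV[C]_n) :
  (diag_mx x \in unitmx) = [forall i, x 0 i != 0].
Proof.
rewrite unitmxE det_diag unitfE.
by apply/prodf_neq0/forallP => x_neq0 i *; exact: x_neq0.
Qed.

Lemma oner_eqN1 : (1 == -1 :> C) = false.
Proof. by rewrite -subr_eq0 opprK -(natrD _ 1 1) pnatr_eq0. Qed.

Lemma diag_formE n (x u : 'rV[C]_n) :
  (u *m diag_mx x *m u ^t*) 0 0 = \sum_k x 0 k * `|u 0 k| ^+ 2.
Proof.
rewrite mul_mx_diag !mxE; apply: eq_bigr => k _.
by rewrite !mxE normCK mulrCA mulrA.
Qed.

(* If fewer [x_k] than [y_k] were positive, some nonzero [z] supported on the
   positive [y_k] would have [z T] vanishing on the positive [x_k]; the two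
   sides of the congruence then give [z] opposite signs. *)
Lemma congr_pos_le m n (T : 'M[C]_(m, n)) (x : 'rV_n) (y : 'rV_m) :
  x \is a mxOver Num.real -> T *m diag_mx x *m T ^t* = diag_mx y ->
  (#|[set k | 0 < y 0 k]%R| <= #|[set k | 0 < x 0 k]%R|)%N.
Proof.
move=> /mxOverP xR Txy; rewrite leqNgt; apply/negP=> ltXY.
set X := [set k | _ < x _ _] in ltXY; set Y := [set k | _ < y _ _] in ltXY.
(* [A] keeps the rows of [T] in [Y] and its columns in [X]. It has more rows than columns, hence a
   nonzero left kernel vector [w], which [z] extends by zero outside [Y]. *)
pose A := mxsub (@enum_val _ (mem Y)) (@enum_val _ (mem X)) T.
have /rowV0Pn[w /sub_kermxP wA0 w_neq0] : kermx A != 0.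
  by rewrite -mxrank_eq0 mxrank_ker subn_eq0 -ltnNge (leq_ltn_trans (rank_leq_col _)).
pose z := w *m rowsub (@enum_val _ (mem Y)) 1%:M.
pose u := z *m T.
have uX0 k : k \in X -> u 0 k = 0.
  move=> Xk; rewrite /u /z -mulmxA mul_rowsub_mx mul1mx.
  move/rowP/(_ (enum_rank_in Xk k)): wA0; rewrite !mxE => wA0.
  by rewrite -[RHS]wA0; apply: eq_bigr => i _; rewrite !mxE enum_rankK_in.
have zY i : z 0 (enum_val i) = w 0 i.
  rewrite mxE (bigD1 i) //= !mxE eqxx mulr1 big1 ?addr0 // => j ji.
  by rewrite !mxE (inj_eq enum_val_inj) (negPf ji) mulr0.
have zY0 k : k \notin Y -> z 0 k = 0.
  move=> Yk; rewrite mxE big1 // => i _; rewrite !mxE.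
  by case: eqP Yk => [<-|_]; rewrite ?enum_valP ?mulr0.
have := diag_formE y z; rewrite -Txy.
have -> : z *m (T *m diag_mx x *m T ^t*) *m z ^t* = u *m diag_mx x *m u ^t*.
  rewrite /u; clearbody z.
  by rewrite trmxC_mul !mulmxA.
rewrite diag_formE => /eqP; rewrite lt_eqF //.
apply: (@le_lt_trans _ _ 0).
  apply: sumr_le0 => k _; have [Xk|] := boolP (k \in X).
    by rewrite uX0 // normr0 expr0n mulr0.
  (* The order on [C] is partial: it is the realness of [x] that turns a failure of positivity into
     [x 0 k <= 0]. *)
  rewrite inE -real_leNgt ?rpred0 // => xk.
  by rewrite mulr_le0_ge0 ?exprn_ge0.
have ge0 k : 0 <= y 0 k * `|z 0 k| ^+ 2.
  have [|Yk] := boolP (k \in Y); last by rewrite zY0 // normr0 expr0n mulr0.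
  by rewrite inE => /ltW yk; rewrite mulr_ge0 ?exprn_ge0.
have /rV0Pn[i wi] := w_neq0.
rewrite (bigD1 (enum_val i)) //= ltr_pwDl ?sumr_ge0 //.
by rewrite zY mulr_gt0 ?exprn_gt0 ?normr_gt0 //; have := enum_valP i; rewrite inE.
Qed.

(** Applying [congr_pos_le] in both directions to [M], then to [- M], shows that 1 and -1 occur
    equally often in [x] and [y]. The zeros fill the remaining places, so the two rows agree as
    multisets. *)
Lemma sylvester_perm n (M V W : 'M[C]_n) (x y : 'rV_n) :
  (forall i, x 0 i \in [:: 1; -1; 0]) -> (forall i, y 0 i \in [:: 1; -1; 0]) ->
  V \in unitmx -> W \in unitmx ->
  V *m M *m V ^t* = diag_mx x -> W *m M *m W ^t* = diag_mx y ->
  exists s : 'S_n, forall i, y 0 i = x 0 (s i).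
Proof.
have pos1 (z : 'rV[C]_n) : (forall i, z 0 i \in [:: 1; -1; 0]) ->
    [set k | 0 < z 0 k] = [set k | z 0 k == 1].
  move=> zP; apply/setP=> k; rewrite !inE; have := zP k; rewrite !inE.
  case/or3P=> /eqP ->; rewrite ?ltr01 ?eqxx ?ltxx ?oppr_gt0 ?ltr10 //.
    by rewrite eq_sym oner_eqN1.
  by rewrite eq_sym oner_eq0.
have real (z : 'rV[C]_n) : (forall i, z 0 i \in [:: 1; -1; 0]) ->
    z \is a mxOver Num.real.
  move=> zP; apply/mxOverP=> i k; rewrite ord1; have := zP k; rewrite !inE.
  by case/or3P=> /eqP ->; rewrite ?rpredN ?rpred1 ?rpred0.
have sgnN (z : 'rV[C]_n) : (forall i, z 0 i \in [:: 1; -1; 0]) ->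
    forall i, (- z) 0 i \in [:: 1; -1; 0].
  move=> zP k; rewrite mxE; have := zP k; rewrite !inE.
  by case/or3P=> /eqP ->; rewrite ?opprK ?oppr0 eqxx ?orbT.
have le1 (N P Q : 'M[C]_n) (a b : 'rV[C]_n) :
    (forall i, a 0 i \in [:: 1; -1; 0]) -> (forall i, b 0 i \in [:: 1; -1; 0]) ->
    P \in unitmx -> P *m N *m P ^t* = diag_mx a -> Q *m N *m Q ^t* = diag_mx b ->
    (#|[set k | b 0 k == 1]%R| <= #|[set k | a 0 k == 1]%R|)%N.
  move=> aP bP Pu Pa Qb; rewrite -!pos1 //.
  (* Passing through [N], the matrix [Q *m invmx P] carries [diag_mx a] to [diag_mx b]. *)
  apply: (@congr_pos_le _ _ (Q *m invmx P)); first exact: real.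
  have PtU : P ^t* \in unitmx by rewrite trmxC_unit.
  by rewrite -Pa -Qb trmxC_mul trmxC_inv !mulmxA mulmxKV // mulmxK.
move=> xP yP Vu Wu Vx Wy.
have eq1 : #|[set k | y 0 k == 1]| = #|[set k | x 0 k == 1]|.
  by apply/eqP; rewrite eqn_leq (le1 M V W) // (le1 M W V).
have eqN1 : #|[set k | y 0 k == -1]| = #|[set k | x 0 k == -1]|.
  have VxN : V *m (- M) *m V ^t* = diag_mx (- x).
    by rewrite mulmxN mulNmx Vx raddfN.
  have WyN : W *m (- M) *m W ^t* = diag_mx (- y).
    by rewrite mulmxN mulNmx Wy raddfN.
  have setN (z : 'rV[C]_n) : [set k | z 0 k == -1] = [set k | (- z) 0 k == 1].
    by apply/setP=> k; rewrite !inE mxE eqr_oppLR.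
  apply/eqP; rewrite !setN eqn_leq.
  by rewrite (le1 (- M) V W) ?(le1 (- M) W V) //; exact: sgnN.
pose t (z : 'rV[C]_n) := [tuple z 0 i | i < n].
suff /tuple_permP[s /val_inj ts] : perm_eq (t y) (t x).
  exists s => i; have := congr1 (fun u => tnth u i) ts; by rewrite !tnth_mktuple.
have countE (z : 'rV[C]_n) a : count_mem a (t z) = #|[set k | z 0 k == a]|.
  by rewrite /= count_map -sum1_count big_enum_cond -sum1dep_card.
have set0E (z : 'rV[C]_n) : (forall i, z 0 i \in [:: 1; -1; 0]) ->
    #|[set k | z 0 k == 0]| =
    (n - (#|[set k | z 0 k == 1]%R| + #|[set k | z 0 k == -1]%R|))%N.
  move=> zP; rewrite -cardsUI (_ : _ :&: _ = set0); last first.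
    apply/setP=> k; rewrite !inE; apply/andP=> -[/eqP->].
    by rewrite oner_eqN1.
  rewrite cards0 addn0; set A := _ :|: _.
  rewrite -[X in (X - _)%N]card_ord -(cardsC A) addKn; apply: eq_card => k.
  rewrite !inE; have := zP k; rewrite !inE.
  case/or3P=> /eqP ->; rewrite ?eqxx ?oppr_eq0 ?oner_eq0 ?orbT //.
  by rewrite eq_sym oner_eq0 eq_sym oppr_eq0 oner_eq0.
apply/allP=> a; rewrite mem_cat /= !countE => /orP ta.
have {ta} : a \in [:: 1; -1; 0] by case: ta => /mapP[i _ ->].
rewrite !inE => /or3P[]/eqP->; apply/eqP => //.
by rewrite !set0E // eq1 eqN1.
Qed.

(** A unitary diagonalization has real eigenvalues; scaling each eigenvector by a positive factor
    reduces its eigenvalue to the sign. *)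
Lemma hermitian_sign_congr n (M : 'M[C]_n) : M \is hermsymmx ->
  exists V : 'M[C]_n, exists x : 'rV[C]_n,
  [/\ V \in unitmx, forall i, x 0 i \in [:: 1; -1; 0]
    & V *m M *m V ^t* = diag_mx x].
Proof.
move=> Mh; have /orthomx_spectralP := hermitian_normalmx Mh.
have /mxOverP := hermitian_spectral_diag_real Mh.
set P := spectralmx M; set d := spectral_diag M => dR Md.
have Pu : P \in unitmx := spectral_unit M.
have PV : invmx P = P ^t* by rewrite invmx_unitary ?spectral_unitarymx.
(* The factor enters twice in the congruence, hence the square root of the modulus. The value 1 at a
   zero eigenvalue keeps [diag_mx c] invertible. *)
pose c := \row_i (if d 0 i == 0 then 1 else (sqrtC `|d 0 i|)^-1).
have c_gt0 i : 0 < c 0 i.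
  by rewrite mxE; case: eqP => // /eqP di; rewrite invr_gt0 sqrtC_gt0 normr_gt0.
exists (diag_mx c *m P), (\row_i Num.sg (d 0 i)); split.
- rewrite unitmx_mul Pu andbT diag_mx_unit; apply/forallP=> i.
  by rewrite lt0r_neq0.
- move=> i; rewrite mxE sgr_def !inE; case: (d 0 i =P 0) => _;
    by case: (_ < 0); rewrite ?mulr1n ?mulr0n ?expr0 ?expr1 ?eqxx ?orbT.
rewrite trmxC_mul trmxC_diag -PV {1}Md !mulmxA mulmxK // mulmxK //.
rewrite !mulmx_diag; congr diag_mx; apply/rowP=> i.
have -> : c ^ Num.conj = c.
  by apply/rowP=> j; rewrite mxE geC0_conj ?ltW.
rewrite !mxE; case: eqP => [->|/eqP di]; first by rewrite sgr0 mulr0 mul0r.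
rewrite mulrC mulrA -invfM -expr2 sqrtCK [X in _ * X](realEsg (dR 0 i)).
by rewrite mulrCA mulVf ?mulr1 ?normr_eq0.
Qed.
End Inertia.

(** * Signs of the summands and existence of the canonical form *)

Section PairCanonicalForm.
Variables (R : realType) (n : nat).
Implicit Types (E Q : 'M[R[i]]_n) (d : 'I_n -> 'M[R[i]]_1 * 'M[R[i]]_1).

Definition pair_sign (p : 'M[R[i]]_1 * 'M[R[i]]_1) : R[i] :=
  (p.1 0 0)^* * p.2 0 0.

Lemma pair_canonical_form_congr E Q d : pair_canonical_form E Q d ->
  exists2 V : 'M[R[i]]_n, V \in unitmx &
    V *m (E ^t* *m Q) *m V ^t* = diag_mx (\row_i pair_sign (d i)).
Proof.
case=> -[U [V [Uu Vu [UE UQ]]]] _ _.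
(* The adjoint appears because the inertia lemmas write congruence as $VMV^*$. In
   $(UEV)^*(U^{-*}QV)$ the factor $U^*$ cancels $U^{-*}$. *)
exists (V ^t*); first by rewrite trmxC_unit.
have UtU : U ^t* \in unitmx by rewrite trmxC_unit.
have -> : V ^t* *m (E ^t* *m Q) *m V ^t* ^t* =
    (U *m E *m V) ^t* *m ((invmx U) ^t* *m Q *m V).
  by rewrite trmxCK !trmxC_mul trmxC_inv !mulmxA mulmxK.
rewrite UE UQ !dsum11E trmxC_diag mulmx_diag.
by congr diag_mx; apply/rowP=> i; rewrite !mxE.
Qed.

Lemma pair_signE :
  [/\ pair_sign (1, 1) = 1, pair_sign (1, -1) = -1, pair_sign (1, 0) = 0
    & pair_sign (0, 1) = 0].
Proof.
by split; rewrite /pair_sign !mxE /= ?mulr1n ?mulr0n ?conjC1 ?conjC0 ?mul1r ?mul0r.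
Qed.

Lemma pair_canonical_form_sign E Q d :
  (E \in unitmx) || (Q \in unitmx) -> pair_canonical_form E Q d ->
  forall i, pair_sign (d i) \in [:: 1; -1; 0].
Proof.
have [s1 sN1 s0 s0'] := pair_signE.
case/orP=> [Eu|Qu] [_ dE dQ] i; [have := dE Eu i|have := dQ Qu i];
  by rewrite !inE => /or3P[]/eqP->; rewrite ?s1 ?sN1 ?s0 ?s0' eqxx ?orbT.
Qed.

(** Only (1, 0) and (0, 1) share a sign, namely 0. Nonsingularity of [E] rules out the second in
    both forms, that of [Q] the first. *)
Lemma pair_sign_inj E Q d d' :
  (E \in unitmx) || (Q \in unitmx) ->
  pair_canonical_form E Q d -> pair_canonical_form E Q d' ->
  forall i j, pair_sign (d i) = pair_sign (d' j) -> d i = d' j.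
Proof.
have [s1 sN1 s0 s0'] := pair_signE.
have n10 : (1 == 0 :> R[i]) = false by rewrite oner_eq0.
have nN0 : (-1 == 0 :> R[i]) = false by rewrite oppr_eq0.
pose neqE := (oner_eqN1, n10, nN0, eq_sym (-1) 1, eq_sym 0 1, eq_sym 0 (-1)).
by case/orP=> [Eu|Qu] [_ dE dQ] [_ dE' dQ'] i j;
  [have := dE Eu i; have := dE' Eu j|have := dQ Qu i; have := dQ' Qu j];
  rewrite !inE => /or3P[]/eqP-> /or3P[]/eqP->;
  rewrite ?s1 ?sN1 ?s0 ?s0' // => /eqP; rewrite ?neqE.
Qed.

Lemma pair_canonical_form_exists E Q :
  E ^t* *m Q \is hermsymmx -> (E \in unitmx) || (Q \in unitmx) ->
  exists d, pair_canonical_form E Q d.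
Proof.
move=> EQh; have [V [x [Vu xP VMV]]] := hermitian_sign_congr EQh.
have VtU : V ^t* \in unitmx by rewrite trmxC_unit.
(* If both matrices are nonsingular, the construction for [Q] is used, and its summands must also
   lie in the list for [E]. *)
have [Qu _|Qu] := boolP (Q \in unitmx); last first.
  rewrite orbF => Eu; exists (fun i => (1, (x 0 i)%:M)); split=> [|_ i|]; last 1 first.
  - by rewrite (negPf Qu).
  - have EVu : E *m V ^t* \in unitmx by rewrite unitmx_mul Eu.
    (* With this choice $U^{-*}=VE^*$, so the second component becomes $VE^*QV^*$, which is
       [diag_mx x]. *)
    exists (invmx (E *m V ^t*)), (V ^t*); split=> //; first by rewrite unitmx_inv.
    rewrite invmxK trmxC_mul trmxCK -mulmxA mulVmx // -[_ *m _ *m Q]mulmxA VMV.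
    rewrite /pair_dsum11 !dsum11E /=; congr (_, diag_mx _).
      by rewrite -diag_const_mx; congr diag_mx; apply/rowP=> i; rewrite !mxE.
    by apply/rowP=> i; rewrite !mxE mulr1n.
  - have := xP i; rewrite !inE => /or3P[]/eqP->; first by rewrite eqxx.
      by rewrite raddfN eqxx orbT.
    by rewrite raddf0 eqxx !orbT.
(* A zero sign must come from (0, 1) here, whence the value 1. All entries of [b] are 1 or -1, so
   [diag_mx b] is Hermitian and its own inverse. *)
pose b := \row_i (if x 0 i == 0 then 1 else x 0 i).
have bP i : b 0 i \in [:: 1; -1].
  rewrite mxE; have := xP i; rewrite !inE.
  by case: ifP => _; rewrite ?eqxx // orbF.
have bb i : b 0 i * b 0 i = 1.
  by have := bP i; rewrite !inE => /orP[]/eqP->; rewrite ?mulrNN mulr1.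
have b_conj : b ^ Num.conj = b.
  apply/rowP=> i; rewrite mxE; have := bP i; rewrite !inE.
  by case/orP=> /eqP->; rewrite ?rmorphN rmorph1.
have BB : diag_mx b *m diag_mx b = 1%:M.
  rewrite mulmx_diag -diag_const_mx; congr diag_mx.
  by apply/rowP=> i; rewrite !mxE -[RHS](bb i) mxE.
have Bu : diag_mx b \in unitmx by case: (mulmx1_unit BB).
have QtE : Q ^t* *m E = E ^t* *m Q.
  have := elimT (is_hermitianmxP _ _ _) EQh.
  by rewrite expr0 scale1r => ->; rewrite trmxC_mul trmxCK.
exists (fun i => ((x 0 i * b 0 i)%:M, (b 0 i)%:M)); split=> [|Eu i|_ i].
(* Write $B$ for [diag_mx b]. Then $U^*=QV^*B$, hence $U^{-*}QV^*=B$, while $UEV^*=BVQ^*EV^*$ is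
   diagonal because $Q^*E=E^*Q$. *)
- exists (diag_mx b *m V *m Q ^t*), (V ^t*); split=> //.
    by rewrite !unitmx_mul Bu Vu trmxC_unit.
  rewrite trmxC_inv !trmxC_mul trmxCK trmxC_diag b_conj.
  rewrite /pair_dsum11 !dsum11E /=; congr (_, _).
    rewrite -[_ *m E]mulmxA QtE -2!mulmxA [V *m _]mulmxA VMV mulmx_diag.
    by congr diag_mx; apply/rowP=> i; rewrite !mxE mulr1n mulrC.
  set S := Q *m _.
  have Su : S \in unitmx by rewrite !unitmx_mul Qu VtU.
  have SB : S *m diag_mx b = Q *m V ^t* by rewrite -!mulmxA BB mulmx1.
  rewrite -mulmxA -SB mulKmx //; congr diag_mx.
  by apply/rowP=> i; rewrite !mxE mulr1n.
(* With [E] nonsingular too, [diag_mx x] is a product of invertible matrices; no sign vanishes, so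
   [b] equals [x] and the first entry is 1. *)
- have x_neq0 : x 0 i != 0.
    have : diag_mx x \in unitmx.
      by rewrite -VMV !unitmx_mul Vu VtU Qu trmxC_unit Eu.
    by rewrite diag_mx_unit => /forallP.
  have bx : b 0 i = x 0 i by rewrite mxE (negPf x_neq0).
  by rewrite -{1}bx bb !inE; have := bP i; rewrite !inE => /orP[]/eqP->;
    rewrite ?raddfN eqxx ?orbT.
- have [x0|x_neq0] := eqVneq (x 0 i) 0.
    by rewrite mxE x0 eqxx mul0r raddf0 !inE eqxx !orbT.
  have bx : b 0 i = x 0 i by rewrite mxE (negPf x_neq0).
  by rewrite -{1}bx bb !inE; have := bP i; rewrite !inE => /orP[]/eqP->;
    rewrite ?raddfN eqxx ?orbT.
Qed.
End PairCanonicalForm.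

Theorem theorem3p6 (R : realType) (n : nat) (E Q : 'M[R[i]]_n)
    (hEQ : E ^t* *m Q \is hermsymmx)
    (hns : (E \in unitmx) || (Q \in unitmx)) :
  [/\ exists d : 'I_n -> 'M[R[i]]_1 * 'M[R[i]]_1,
        pair_canonical_form E Q d,
      psdmx (E ^t* *m Q) ->
        forall d : 'I_n -> 'M[R[i]]_1 * 'M[R[i]]_1,
        pair_canonical_form E Q d -> forall i, d i <> (1, -1)
    & forall d d' : 'I_n -> 'M[R[i]]_1 * 'M[R[i]]_1,
        pair_canonical_form E Q d -> pair_canonical_form E Q d' ->
        exists s : 'S_n, forall i, d' i = d (s i)].
Proof.
split; first exact: pair_canonical_form_exists.
- move=> [_ psd] d dC i di.
  have [V _ VMV] := pair_canonical_form_congr dC.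
  (* Testing semidefiniteness on [V ^t* *m e] reads off the [i]-th diagonal sign, which would be
     -1. *)
  pose e : 'cV[R[i]]_n := delta_mx i 0.
  have := psd (V ^t* *m e).
  have -> : (V ^t* *m e) ^t* *m (E ^t* *m Q) *m (V ^t* *m e) =
      e ^t* *m (V *m (E ^t* *m Q) *m V ^t*) *m e.
    by rewrite trmxC_mul trmxCK !mulmxA.
  rewrite VMV /e trmx_delta map_delta_mx -rowE -colE !mxE eqxx mulr1n di.
  by have [_ -> _ _] := pair_signE R; rewrite oppr_ge0 ler10.
- move=> d d' dC dC'.
  have [V Vu VMV] := pair_canonical_form_congr dC.
  have [W Wu WMW] := pair_canonical_form_congr dC'.
  have sgnP e : pair_canonical_form E Q e ->
      forall i, (\row_i pair_sign (e i)) 0 i \in [:: 1; -1; 0].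
    by move=> eC i; rewrite mxE; exact: pair_canonical_form_sign eC i.
  have [s sP] := sylvester_perm (sgnP _ dC) (sgnP _ dC') Vu Wu VMV WMW.
  exists s => i; apply: (pair_sign_inj hns dC' dC).
  by have := sP i; rewrite !mxE.
Qed.
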